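(* Let $G_0$ be the connected component of the identity of $\mathsf{GL}(2,\mathbb{R})$ with the bi-invariant Lorentzian metric $k^+$ determined by $k(u,v)=\mathrm{trace}(u\circ v)$ on $\mathfrak{g}=\mathfrak{gl}(2,\mathbb{R})$. Let $\sigma\in G_0$ and let $0\ne v_\sigma=\sum_{i=1}^4 f_i\,e_{i,\sigma}^+\in T_\sigma(G_0)$ with $f_i\in\mathbb{R}$. Then the tidal force operator $F_{v_\sigma}$ satisfies $$\mathrm{trace}(F_{v_\sigma})=-R_{icci}(v_\sigma,v_\sigma)=-f_1^2+f_2^2+f_3^2 .$$
   Context: For $u\in\mathfrak{g}$, $u^+$ denotes the left-invariant vector field on $G_0$ with value $u$ at the identity, $u^+_\sigma$ its value at $\sigma$, and $k^+$ is the left-invariant (in fact bi-invariant) metric with $k^+(u^+,v^+)=k(u,v)$. The $k$-orthonormal basis is $$e_1=\tfrac{\sqrt2}{2}\begin{pmatrix}0&1\\-1&0\end{pmatrix},\quad e_2=\tfrac{\sqrt2}{2}\begin{pmatrix}0&1\\1&0\end{pmatrix},\quad e_3=\tfrac{\sqrt2}{2}\begin{pmatrix}1&0\\0&-1\end{pmatrix},\quad e_4=\tfrac{\sqrt2}{2}\begin{pmatrix}1&0\\0&1\end{pmatrix}.$$ The curvature tensor is (with the paper's sign convention) $R_{u^+v^+}w^+:=\frac14[[u^+,v^+],w^+]$, and the Ricci tensor is $R_{icci}(u^+,v^+):=-\frac14\mathrm{trace}(\mathrm{ad}_u\circ\mathrm{ad}_v)$. For $0\ne v\in T_\sigma(G_0)$,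 the tidal force operator is the linear map $F_v:v^\perp\to v^\perp$, $F_v(y)=R_{yv}v$, where $v^\perp$ is the $k^+$-orthogonal complement of $v$ in $T_\sigma(G_0)$. *)

(* Defs.v *)
From HB Require Import structures.
From mathcomp Require Import all_boot all_order all_algebra.
From mathcomp Require Import all_classical all_reals all_analysis.

Set Implicit Arguments.
Unset Strict Implicit.
Unset Printing Implicit Defensive.
Import Order.TTheory GRing.Theory Num.Theory.
Import numFieldNormedType.Exports.
Local Open Scope classical_set_scope.
Local Open Scope ring_scope.

(* [passmx.mxof] is the matrix of F in a basis, acting on row vectors. *)
Definition lfun_trace (K : fieldType) (V : vectType K) (F : 'End(V)) : K :=
  \tr (passmx.mxof (vbasis {:V}) (vbasis {:V}) F).

Section GL2.
Variable R : realType.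
Implicit Types (u v w x y sigma : 'M[R]_2) (X Y : 'M[R]_2 -> 'M[R]_2).

Definition GL2 : set 'M[R]_2 := [set sigma | sigma \in unitmx].

(* GL2 is open in 'M[R]_2, so every tangent space of G0 is identified with
   'M[R]_2 and vector fields with functions 'M[R]_2 -> 'M[R]_2. *)
Definition G0 : set 'M[R]_2 := connected_component GL2 1%:M.

Definition ad u w : 'M[R]_2 := u *m w - w *m u.

Definition k u v : R := \tr (u *m v).

Definition left_field u : 'M[R]_2 -> 'M[R]_2 := fun sigma => sigma *m u.

Definition at_identity sigma x : 'M[R]_2 := invmx sigma *m x.

Definition kplus sigma x y : R := k (at_identity sigma x) (at_identity sigma y).

Definition lie_bracket X Y : 'M[R]_2 -> 'M[R]_2 :=
  fun sigma => 'D_(X sigma) Y sigma - 'D_(Y sigma) X sigma.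

(* R_{xy}w for tangent vectors x, y, w at sigma, each extended to the
   left-invariant vector field through it. *)
Definition curvature sigma x y w : 'M[R]_2 :=
  4^-1 *: lie_bracket
            (lie_bracket (left_field (at_identity sigma x))
                         (left_field (at_identity sigma y)))
            (left_field (at_identity sigma w)) sigma.

Definition ricci sigma x y : R :=
  - (4^-1 * lfun_trace (linfun (ad (at_identity sigma x)) \o
                        linfun (ad (at_identity sigma y)))%VF).

Definition orth sigma v : {vspace 'M[R]_2} :=
  lker (linfun (kplus sigma v : 'M[R]_2 -> R^o)).

Definition e1 : 'M[R]_2 := (Num.sqrt 2 / 2) *:
  \matrix_(i, j) (if i == j then 0 else if (i < j)%N then 1 else -1).
Definition e2 : 'M[R]_2 := (Num.sqrt 2 / 2) *:
  \matrix_(i, j) (if i == j then 0 else 1).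
Definition e3 : 'M[R]_2 := (Num.sqrt 2 / 2) *:
  \matrix_(i, j) (if i == j then if i == 0 then 1 else -1 else 0).
Definition e4 : 'M[R]_2 := (Num.sqrt 2 / 2) *: 1%:M.

Lemma G0_unit sigma : G0 sigma -> sigma \in unitmx.
Proof. by move=> [C [_ sub _] /sub]. Qed.

Fact ad_is_linear u : linear (ad u).
Proof.
move=> a x y; rewrite /ad mulmxDr mulmxDl -scalemxAr -scalemxAl.
by rewrite scalerBr opprD addrACA.
Qed.
HB.instance Definition _ u := GRing.isLinear.Build R _ _ _ (ad u) (ad_is_linear u).

Fact ad_anti u w : ad u w = - ad w u.
Proof. by rewrite /ad opprB. Qed.

Fact kplus_is_linear sigma v : linear (kplus sigma v : 'M[R]_2 -> R^o).
Proof.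
move=> a x y; rewrite /kplus /k /at_identity !mulmxDr mxtraceD.
by rewrite -!scalemxAr mxtraceZ.
Qed.
HB.instance Definition _ sigma v :=
  GRing.isLinear.Build R _ _ _ (kplus sigma v : 'M[R]_2 -> R^o)
    (kplus_is_linear sigma v).

Lemma kplus_left_field sigma u v : sigma \in unitmx ->
  kplus sigma (left_field u sigma) (left_field v sigma) = k u v.
Proof. by move=> s1; rewrite /kplus /at_identity /left_field !mulKmx. Qed.

Lemma mem_orth sigma v y : (y \in orth sigma v) = (kplus sigma v y == 0).
Proof. by rewrite memv_ker lfunE. Qed.

Lemma derive_left_field u x sigma : 'D_x (left_field u) sigma = x *m u.
Proof.
rewrite /derive; apply: cvg_lim => //.
apply: cvg_near_cst; near=> h.
have h0 : h != 0 by near: h; exact: nbhs_dnbhs_neq.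
rewrite /left_field /= mulmxDl addrK -scalemxAl scalerA mulVf ?scale1r //.
Unshelve. all: by end_near. Qed.

Lemma lie_bracket_left_field u v :
  lie_bracket (left_field u) (left_field v) = left_field (ad u v).
Proof.
apply/funext => sigma; rewrite /lie_bracket !derive_left_field /left_field /ad.
by rewrite mulmxBr !mulmxA.
Qed.

Lemma curvatureE sigma x y w : curvature sigma x y w =
  4^-1 *: (sigma *m ad (ad (at_identity sigma x) (at_identity sigma y))
                       (at_identity sigma w)).
Proof. by rewrite /curvature !lie_bracket_left_field. Qed.

Lemma curvature_orth sigma (hsigma : G0 sigma) v y :
  curvature sigma y v v \in orth sigma v.
Proof.
rewrite mem_orth curvatureE /kplus {2}/at_identity -scalemxAr mulmxA.
rewrite mulVmx ?G0_unit // mul1mx /k -scalemxAr mxtraceZ.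
set a := at_identity sigma v; move: (ad (at_identity sigma y) a) => b.
rewrite /ad mulmxBr raddfB /= (mxtrace_mulC a (b *m a)) (mulmxA a a b).
by rewrite (mxtrace_mulC (a *m a) b) (mulmxA b a a) subrr mulr0 eqxx.
Qed.

Definition tidal_fun sigma (hsigma : G0 sigma) v (y : subvs_of (orth sigma v)) :
  subvs_of (orth sigma v) := Subvs (curvature_orth hsigma v (vsval y)).

Fact tidal_fun_is_linear sigma (hsigma : G0 sigma) v :
  linear (tidal_fun hsigma (v := v)).
Proof.
move=> a x y; apply: val_inj; rewrite /= !curvatureE.
set s := at_identity sigma v.
have adad p : ad (ad p s) s = ad s (ad s p).
  by rewrite (ad_anti _ s) (ad_anti p s) linearN opprK.
have -> : at_identity sigma (a *: vsval x + vsval y) =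
          a *: at_identity sigma (vsval x) + at_identity sigma (vsval y).
  by rewrite /at_identity mulmxDr -scalemxAr.
by rewrite !adad !linearP.
Qed.
HB.instance Definition _ sigma (hsigma : G0 sigma) v :=
  GRing.isLinear.Build R _ _ _ (tidal_fun hsigma (v := v))
    (tidal_fun_is_linear hsigma (v := v)).

Definition tidal_force sigma (hsigma : G0 sigma) v :
  'End(subvs_of (orth sigma v)) := linfun (tidal_fun hsigma (v := v)).

Lemma tidal_forceE sigma (hsigma : G0 sigma) v (y : subvs_of (orth sigma v)) :
  vsval (tidal_force hsigma v y) = curvature sigma (vsval y) v v.
Proof. by rewrite lfunE. Qed.

End GL2.

(* Main.v *)
From HB Require Import structures.
Require Import Defs.
From mathcomp Require Import all_boot all_order all_algebra.
From mathcomp Require Import all_classical all_reals all_analysis.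
From mathcomp Require Import ring.
Import Order.TTheory GRing.Theory Num.Theory.
Import numFieldNormedType.Exports.
Local Open Scope ring_scope.

(** Left translation by [sigma] identifies the tangent space at [sigma] with
    the Lie algebra; let [a] correspond to [v].  Since
    [[y, a], a] = [a, [a, y]], the tidal force is, under this identification,
    the restriction of [4^-1 ad_a^2] to the orthogonal complement of [v].

    The first equality says that this restriction has the same trace as
    [4^-1 ad_a^2] on the whole Lie algebra.  The reason is that [k] is
    ad-invariant, so that the image of [ad_a^2] already lies in the orthogonal
    complement of [a].  Concretely, let [i] be the inclusion of the complement
    into the Lie algebra and [p] the map [4^-1 ad_a^2] from the Lie algebra to
    the complement: the tidal force is [p \o i] while [4^-1 ad_a^2] is
    [i \o p], and the two have equal traces ([lfun_trace_comp]).  No splitting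
    of the tangent space is involved, so a lightlike [v], which lies in its own
    orthogonal complement, is covered like any other.

    For the second equality, the map [x |-> a x b] on square matrices has trace
    [tr a * tr b] ([sum_mul_delta_mx]), whence
    [tr (ad_a^2) = 4 tr (a^2) - 2 (tr a)^2] in size two
    ([lfun_trace_ad2]).  In the coordinates [f_i] the form [tr (a^2)] has
    signature [(-,+,+,+)] and [tr a = sqrt 2 * f4], so the contribution of the
    central direction [e4] cancels. *)

(** A spanning family with coordinate forms computes the trace even when it is
    not free: expanding the vectors of the reference basis along [e], then
    recombining the other way round, exchanges the two families. *)
Lemma lfun_trace_frame (K : fieldType) (V : vectType K) (I : finType)
    (e : I -> V) (c : I -> {scalar V}) (F : 'End(V)) :
  (forall x, x = \sum_i c i x *: e i) -> lfun_trace F = \sum_i c i (F (e i)).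
Proof.
move=> ec; rewrite /lfun_trace /mxtrace.
set b := vbasis {:V}.
have bP : basis_of {:V} b by exact: vbasisP.
transitivity (\sum_(k < \dim {:V}) \sum_i c i b`_k * coord b k (F (e i))).
  apply: eq_bigr => k _; rewrite !mxE /= passmx.vecof_delta.
  rewrite {1}[b`_k]ec !linear_sum /=.
  by apply: eq_bigr => i _; rewrite !linearZ.
rewrite exchange_big; apply: eq_bigr => i _ /=.
rewrite [F (e i) in RHS](coord_basis bP (memvf _)) linear_sum.
by apply: eq_bigr => k _; rewrite linearZ /= mulrC.
Qed.

Lemma lfun_traceZ (K : fieldType) (V : vectType K) (a : K) (F : 'End(V)) :
  lfun_trace (a *: F) = a * lfun_trace F.
Proof.
rewrite /lfun_trace -mxtraceZ; congr (\tr _); apply/matrixP => i j.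
by rewrite !mxE /= scale_lfunE linearZ.
Qed.

Lemma lfun_trace_comp (K : fieldType) (U V : vectType K)
    (f : 'Hom(U, V)) (g : 'Hom(V, U)) :
  lfun_trace (g \o f)%VF = lfun_trace (f \o g)%VF.
Proof.
rewrite /lfun_trace.
rewrite (passmx.mxof_comp _ _ (vbasisP {:V})).
by rewrite (passmx.mxof_comp _ _ (vbasisP {:U})) mxtrace_mulC.
Qed.

Lemma lfun_trace_mx (K : fieldType) (m n : nat) (F : 'End('M[K]_(m, n))) :
  lfun_trace F = \sum_i \sum_j F (delta_mx i j) i j.
Proof.
have lin (p : 'I_m * 'I_n) : scalar (fun x : 'M[K]_(m, n) => x p.1 p.2).
  by move=> t x y; rewrite !mxE.
pose c p : {scalar 'M[K]_(m, n)} :=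
  HB.pack (fun x : 'M[K]_(m, n) => x p.1 p.2)
    (GRing.isLinear.Build K _ _ _ _ (lin p)).
rewrite (@lfun_trace_frame _ _ _ (fun p => delta_mx p.1 p.2) c).
  by rewrite pair_bigA.
by move=> x; rewrite {1}[x]matrix_sum_delta pair_bigA.
Qed.

(** The left-hand side is the trace of [x |-> a x b], read off on matrix units.
    With ['M_n] seen as the tensor product of columns and rows, that map is the
    tensor product of two maps of traces [\tr a] and [\tr b]. *)
Lemma sum_mul_delta_mx (K : fieldType) (n : nat) (a b : 'M[K]_n) :
  \sum_i \sum_j (a *m delta_mx i j *m b) i j = \tr a * \tr b.
Proof.
rewrite /mxtrace mulr_suml; apply: eq_bigr => i _.
rewrite mulr_sumr; apply: eq_bigr => j _.
rewrite -(mul_delta_mx (0 : 'I_1)) mulmxA -mulmxA -colE -rowE.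
by rewrite mxE big_ord1 !mxE.
Qed.

(** The square of [ad a] is [x |-> a^2 x - 2 a x a + x a^2], and the leading
    coefficient [4] is twice [\tr 1%:M], the contribution of the two outer
    terms. *)
Lemma lfun_trace_ad2 (R : realType) (a : 'M[R]_2) :
  lfun_trace (linfun (ad a) \o linfun (ad a))%VF
    = 4 * \tr (a *m a) - 2 * (\tr a) ^+ 2.
Proof.
rewrite lfun_trace_mx.
pose s (b c : 'M[R]_2) := \sum_i \sum_j (b *m delta_mx i j *m c) i j.
have sE b c : s b c = \tr b * \tr c by exact: sum_mul_delta_mx.
transitivity (s (a *m a) 1%:M - s a a - s a a + s 1%:M (a *m a)).
  rewrite /s -!sumrB -big_split /=; apply: eq_bigr => i _.
  rewrite -!sumrB -big_split /=; apply: eq_bigr => j _.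
  rewrite comp_lfunE !lfunE /= /ad mulmxBr mulmxBl !mulmxA mulmx1 mul1mx.
  by rewrite !mxE; ring.
by rewrite !sE mxtrace1; ring.
Qed.

Lemma ad_ad_comm (R : realType) (a x : 'M[R]_2) :
  ad (ad x a) a = ad a (ad a x).
Proof. by rewrite ad_anti (ad_anti x a) linearN opprK. Qed.

(** Exchanging the two factors of the tidal force turns an operator on the
    complement of [v] into one on the whole Lie algebra, so that no basis of the
    complement has to be chosen. *)
Lemma lfun_trace_tidal_force {R : realType} {sigma : 'M[R]_2}
    (hsigma : G0 sigma) (v : 'M[R]_2) :
  lfun_trace (tidal_force hsigma v) = - ricci sigma v v.
Proof.
set a := at_identity sigma v.
have su : sigma \in unitmx by exact: G0_unit.
pose i := (linfun (mulmx (invmx sigma)) \o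
           linfun (vsval : subvs_of (orth sigma v) -> _))%VF.
pose p := (linfun (vsproj (orth sigma v)) \o linfun (mulmx sigma) \o
           (4^-1 *: (linfun (ad a) \o linfun (ad a))))%VF.
(* The inclusion [i] is composed with the translation to the identity, and the
   projection in [p] is harmless because [curvature_orth] places the argument
   in the complement already. *)
have iE y : i y = invmx sigma *m vsval y by rewrite comp_lfunE !lfunE.
have pE x : vsval (p x) = curvature sigma (sigma *m x) v v.
  have E : curvature sigma (sigma *m x) v v
         = sigma *m (4^-1 *: ad a (ad a x)).
    by rewrite curvatureE -/a /at_identity mulKmx // -scalemxAr ad_ad_comm.
  rewrite !comp_lfunE scale_lfunE comp_lfunE !lfunE /= vsprojK -E //.
  exact: curvature_orth.
have -> : tidal_force hsigma v = (p \o i)%VF.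
  apply/lfunP => y; apply: val_inj.
  by rewrite /= tidal_forceE comp_lfunE pE iE mulKVmx.
rewrite lfun_trace_comp /ricci opprK -/a -lfun_traceZ.
congr lfun_trace; apply/lfunP => x.
rewrite comp_lfunE iE pE.
rewrite curvatureE -/a /at_identity mulKmx // -scalemxAr mulKmx //.
by rewrite ad_ad_comm scale_lfunE comp_lfunE !lfunE.
Qed.

Theorem lemma4 (R : realType) (sigma : 'M[R]_2) (hsigma : G0 sigma)
    (f1 f2 f3 f4 : R) (v : 'M[R]_2)
    (hv : v = f1 *: left_field (e1 R) sigma + f2 *: left_field (e2 R) sigma
            + f3 *: left_field (e3 R) sigma + f4 *: left_field (e4 R) sigma)
    (v_neq0 : v <> 0) :
  lfun_trace (tidal_force hsigma v) = - ricci sigma v v /\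
  - ricci sigma v v = - f1 ^+ 2 + f2 ^+ 2 + f3 ^+ 2.
Proof.
split; first exact: lfun_trace_tidal_force.
have aE : at_identity sigma v =
    f1 *: e1 R + f2 *: e2 R + f3 *: e3 R + f4 *: e4 R.
  rewrite hv /left_field !scalemxAr -!mulmxDr /at_identity mulKmx //.
  exact: G0_unit.
rewrite /ricci opprK lfun_trace_ad2 aE.
rewrite /mxtrace !big_ord_recl !big_ord0 !mxE !big_ord_recl !big_ord0 !mxE /=.
have s2 : Num.sqrt (2 : R) ^+ 2 = 2 by rewrite sqr_sqrtr.
by field: s2.
Qed.
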